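(* Let $S$ be any full column rank matrix such that $U_-=S\hat U_-$ with $\hat U_-$ of full row rank $k$. The data $(U_-,X,Y_-)$ are informative for stabilization by dynamic measurement feedback if and only if the following two conditions are satisfied: (i) We have $\operatorname{rank}\begin{bmatrix}X_- \\ \hat U_- \end{bmatrix}=n+k$. Equivalently, there exists a matrix $\begin{bmatrix}V_1 & V_2\end{bmatrix}$ such that $$\begin{bmatrix}X_- \\ \hat U_- \end{bmatrix}\begin{bmatrix}V_1 & V_2\end{bmatrix}=\begin{bmatrix}I & 0 \\ 0 & I\end{bmatrix}.$$ (ii) The pair $(X_+V_1,X_+V_2)$ is stabilizable and $(Y_-V_1,X_+V_1)$ is detectable. Moreover, if conditions (i) and (ii) are satisfied, a stabilizing controller $(K,L,M)$ (that is, one with $\Sigma_{i/s/o}\subseteq\Sigma_{K,L,M}$) is constructed as follows: (a) Select a matrix $\hat M$ such that $X_+(V_1+V_2\hat M)$ is stable. Define $M:=S\hat M$. (b) Choose a matrix $L$ such that $(X_+-LY_-)V_1$ is stable. (c) Define $K:=(X_+-LY_-)(V_1+V_2\hat M)$.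
   Context: Fix positive integers $n,m,p,q,T_1,\dots,T_q$. The 'true' system is $x(t+1)=A_sx(t)+B_su(t)$, $y(t)=C_sx(t)+D_su(t)$ with state in $\mathbb{R}^n$, input in $\mathbb{R}^m$, output in $\mathbb{R}^p$. For $i=1,\dots,q$, input/state/output data $u^i(t),y^i(t)$ ($t=0,\dots,T_i-1$) and $x^i(t)$ ($t=0,\dots,T_i$) generated by this system are collected. Put $U_-$, $Y_-$, $X_-$, $X_+$ equal to the matrices obtained by placing side by side, for $i=1,\dots,q$, the blocks $[u^i(0)\cdots u^i(T_i-1)]$, $[y^i(0)\cdots y^i(T_i-1)]$, $[x^i(0)\cdots x^i(T_i-1)]$, $[x^i(1)\cdots x^i(T_i)]$ respectively, and $X$ from the blocks $[x^i(0)\cdots x^i(T_i)]$. Hence $\begin{bmatrix}X_+ \\ Y_- \end{bmatrix}=\begin{bmatrix}A_s & B_s \\ C_s & D_s\end{bmatrix}\begin{bmatrix}X_- \\ U_- \end{bmatrix}$. The set of consistent systems is $$\Sigma_{i/s/o}=\Big\{(A,B,C,D)\ \Big|\ \begin{bmatrix}X_+ \\ Y_- \end{bmatrix}=\begin{bmatrix}A & B \\ C & D\end{bmatrix}\begin{bmatrix}X_- \\ U_- \end{bmatrix}\Big\}$$ (real matrices of sizes $n\times n$, $n\times m$, $p\times n$, $p\times m$). A dynamic controller is $w(t+1)=Kw(t)+Ly(t)$, $u(t)=Mw(t)$ with real matrices $K,L,M$ (any controller state dimension). A square matrix is stable if all its eigenvalues lie in the open unit disk; stabilizability of $(A,B)$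 (existence of $F$ with $A+BF$ stable) and detectability of $(C,A)$ (existence of $G$ with $A-GC$ stable) are in this discrete-time sense. For given $K,L,M$, $$\Sigma_{K,L,M}=\Big\{(A,B,C,D)\ \Big|\ \begin{bmatrix}A & BM \\ LC & K+LDM\end{bmatrix}\text{ is stable}\Big\}.$$ The data $(U_-,X,Y_-)$ are informative for stabilization by dynamic measurement feedback if there exist $K,L,M$ with $\Sigma_{i/s/o}\subseteq\Sigma_{K,L,M}$. *)

(* Defs.v *)
From HB Require Import structures.
From mathcomp Require Import all_boot all_order all_algebra.
From mathcomp Require Import complex.
From mathcomp Require Import classical_sets reals.

Set Implicit Arguments.
Unset Strict Implicit.
Unset Printing Implicit Defensive.

Import Order.TTheory GRing.Theory Num.Theory.
Local Open Scope ring_scope.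
Local Open Scope complex_scope.
Local Open Scope classical_set_scope.

Record system (R : realType) (n m p : nat) := System {
  sysA : 'M[R]_n;
  sysB : 'M[R]_(n, m);
  sysC : 'M[R]_(p, n);
  sysD : 'M[R]_(p, m) }.

(* The eigenvalues are complex: the real matrix is first mapped into R[i]. *)
Definition stable (R : realType) (n : nat) (A : 'M[R]_n) : Prop :=
  forall z : R[i], eigenvalue (map_mx (real_complex R) A) z -> `|z| < 1.

Definition stabilizable (R : realType) (n m : nat)
    (A : 'M[R]_n) (B : 'M[R]_(n, m)) : Prop :=
  exists F : 'M[R]_(m, n), stable (A + B *m F).

Definition detectable (R : realType) (n p : nat)
    (C : 'M[R]_(p, n)) (A : 'M[R]_n) : Prop :=
  exists G : 'M[R]_(n, p), stable (A - G *m C).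

(* [blocks T f] places side by side, for i < q, the blocks
   [f i 0, ..., f i (T i - 1)]. The signals are indexed by all of nat, but only
   their values on the experiment horizons are ever used. *)
Definition blocks (R : realType) (d q : nat) (T : 'I_q -> nat)
    (f : 'I_q -> nat -> 'cV[R]_d) : 'M[R]_(d, \sum_(i < q) T i) :=
  \mxrow_(i < q) \matrix_(r < d, t < T i) f i t r 0.

(* The state data X = [x^i(0), ..., x^i(T_i)] enter only through X_- and X_+. *)
Definition Xminus (R : realType) (n q : nat) (T : 'I_q -> nat)
    (x : 'I_q -> nat -> 'cV[R]_n) : 'M[R]_(n, \sum_(i < q) T i) :=
  blocks T x.

Definition Xplus (R : realType) (n q : nat) (T : 'I_q -> nat)
    (x : 'I_q -> nat -> 'cV[R]_n) : 'M[R]_(n, \sum_(i < q) T i) :=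
  blocks T (fun i t => x i t.+1).

Definition generated_by (R : realType) (n m p q : nat) (T : 'I_q -> nat)
    (s : system R n m p) (u : 'I_q -> nat -> 'cV[R]_m)
    (x : 'I_q -> nat -> 'cV[R]_n) (y : 'I_q -> nat -> 'cV[R]_p) : Prop :=
  forall (i : 'I_q) (t : nat), (t < T i)%N ->
    x i t.+1 = sysA s *m x i t + sysB s *m u i t /\
    y i t = sysC s *m x i t + sysD s *m u i t.

Definition Sigma_iso (R : realType) (n m p q : nat) (T : 'I_q -> nat)
    (u : 'I_q -> nat -> 'cV[R]_m) (x : 'I_q -> nat -> 'cV[R]_n)
    (y : 'I_q -> nat -> 'cV[R]_p) : set (system R n m p) :=
  [set s | col_mx (Xplus T x) (blocks T y) =
           block_mx (sysA s) (sysB s) (sysC s) (sysD s)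
             *m col_mx (Xminus T x) (blocks T u)].

Definition Sigma_KLM (R : realType) (n m p nw : nat)
    (K : 'M[R]_nw) (L : 'M[R]_(nw, p)) (M : 'M[R]_(m, nw)) :
    set (system R n m p) :=
  [set s | stable (block_mx (sysA s)        (sysB s *m M)
                            (L *m sysC s)   (K + L *m sysD s *m M))].

Definition informative (R : realType) (n m p q : nat) (T : 'I_q -> nat)
    (u : 'I_q -> nat -> 'cV[R]_m) (x : 'I_q -> nat -> 'cV[R]_n)
    (y : 'I_q -> nat -> 'cV[R]_p) : Prop :=
  exists (nw : nat) (K : 'M[R]_nw) (L : 'M[R]_(nw, p)) (M : 'M[R]_(m, nw)),
    Sigma_iso T u x y `<=` Sigma_KLM K L M.

Definition is_right_inverse (R : realType) (n k N : nat)
    (Xm : 'M[R]_(n, N)) (Uhat : 'M[R]_(k, N))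
    (V1 : 'M[R]_(N, n)) (V2 : 'M[R]_(N, k)) : Prop :=
  col_mx Xm Uhat *m row_mx V1 V2 = block_mx 1%:M 0 0 1%:M.

Definition stabilizable_detectable (R : realType) (n p k N : nat)
    (Xp : 'M[R]_(n, N)) (Ym : 'M[R]_(p, N))
    (V1 : 'M[R]_(N, n)) (V2 : 'M[R]_(N, k)) : Prop :=
  stabilizable (Xp *m V1) (Xp *m V2) /\ detectable (Ym *m V1) (Xp *m V1).

(* Main.v *)
Require Import Defs.
From mathcomp Require Import all_boot all_order all_algebra.
From mathcomp Require Import complex mxred spectral ring lra.
From mathcomp Require Import classical_sets reals.

(* If (xi, eta) annihilates [X_-; U_hat] from the left, then a rank-one
   perturbation of a consistent system along it changes the trace of the closed
   loop by an arbitrary multiple of |xi|^2; a stable matrix has bounded trace,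
   so xi = 0, and full row rank of U_hat gives eta = 0.  Once (i) holds,
   A, B S, C and D S are determined by the data, and sufficiency is the usual
   observer-based controller.

   For the necessity of (ii), a stable real matrix A admits a W with
   |v A W| < |v W| for all row vectors v <> 0 (Schur triangularization followed
   by an induction on the dimension), and conversely such a W forces stability.
   If [[A, B M], [C, D]] has such a W = [W1; W2], split W2 = P W1 + Z with Z
   orthogonal to W1: Pythagoras shows that W1 is a witness for A + B (M P).
   Detectability follows by transposition. *)

Set Implicit Arguments.
Unset Strict Implicit.
Unset Printing Implicit Defensive.

Import Order.TTheory GRing.Theory Num.Theory.
Local Open Scope ring_scope.
Local Open Scope classical_set_scope.

(** * Squared norms of complex rows; Lyapunov inequality for triangular matrices *)

(** The value lies in [R], not in [R[i]] as for the norm, so that real arithmetic applies to it. *)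
Definition sqmod (R : realType) (z : R[i]) : R :=
  complex.Re z ^+ 2 + complex.Im z ^+ 2.

Lemma sqmod_ge0 (R : realType) (z : R[i]) : 0 <= sqmod z.
Proof. by rewrite addr_ge0 ?sqr_ge0. Qed.

Lemma sqmodM (R : realType) (z w : R[i]) : sqmod (z * w) = sqmod z * sqmod w.
Proof. by case: z w => [a b] [c d]; rewrite /sqmod /=; ring. Qed.

Lemma sqmod_eq0 (R : realType) (z : R[i]) : (sqmod z == 0) = (z == 0).
Proof.
by case: z => a b; rewrite paddr_eq0 ?sqr_ge0// !sqrf_eq0 eq_complex.
Qed.

Lemma sqmod_real (R : realType) (a : R) : sqmod (real_complex R a) = a ^+ 2.
Proof. by rewrite /sqmod /=; ring. Qed.

Lemma norm_lt1 (R : realType) (z : R[i]) : (`|z| < 1) = (sqmod z < 1).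
Proof.
case: z => a b; rewrite normc_def -(rmorph1 (real_complex R)) ltcR /sqmod /=.
by rewrite -{1}sqrtr1 ltr_sqrt.
Qed.

(** Young's inequality: the right side minus the left is [e] times the squared modulus of
    [z - w / e]. *)
Lemma sqmodD_le (R : realType) (e : R) (z w : R[i]) : 0 < e ->
  sqmod (z + w) <= (1 + e) * sqmod z + (1 + e^-1) * sqmod w.
Proof.
case: z w => [a b] [c d] e0; rewrite /sqmod /=.
rewrite -subr_ge0.
have -> : (1 + e) * (a ^+ 2 + b ^+ 2) + (1 + e^-1) * (c ^+ 2 + d ^+ 2)
    - ((a + c) ^+ 2 + (b + d) ^+ 2)
  = e * ((a - c / e) ^+ 2 + (b - d / e) ^+ 2) by field; rewrite gt_eqF.
by rewrite pmulr_rge0// addr_ge0 ?sqr_ge0.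
Qed.

Definition sqnorm (R : realType) (N : nat) (v : 'rV[R[i]]_N) : R :=
  \sum_j sqmod (v 0 j).

Lemma sqnorm_ge0 (R : realType) N (v : 'rV[R[i]]_N) : 0 <= sqnorm v.
Proof. by apply: sumr_ge0 => j _; exact: sqmod_ge0. Qed.

Lemma sqnorm_gt0 (R : realType) N (v : 'rV[R[i]]_N) : v != 0 -> 0 < sqnorm v.
Proof.
move=> v0; rewrite lt_def sqnorm_ge0 andbT; apply: contra v0 => /eqP v0.
apply/eqP/rowP => j; rewrite mxE; apply/eqP; rewrite -sqmod_eq0.
by apply/eqP/(psumr_eq0P _ v0) => // i _; exact: sqmod_ge0.
Qed.

Lemma sqnorm0 (R : realType) N : sqnorm (0 : 'rV[R[i]]_N) = 0.
Proof.
by rewrite /sqnorm big1// => j _; rewrite mxE; apply/eqP; rewrite sqmod_eq0.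
Qed.

Lemma sqnormZ (R : realType) N a (v : 'rV[R[i]]_N) :
  sqnorm (a *: v) = sqmod a * sqnorm v.
Proof. by rewrite mulr_sumr; apply: eq_bigr => j _; rewrite mxE sqmodM. Qed.

Lemma sqnorm_row_mx (R : realType) N1 N2 (v : 'rV[R[i]]_N1) (w : 'rV_N2) :
  sqnorm (row_mx v w) = sqnorm v + sqnorm w.
Proof.
rewrite /sqnorm big_split_ord /=.
by congr (_ + _); apply: eq_bigr => j _; rewrite ?row_mxEl ?row_mxEr.
Qed.

Lemma sqnormD_le (R : realType) (e : R) N (v w : 'rV[R[i]]_N) : 0 < e ->
  sqnorm (v + w) <= (1 + e) * sqnorm v + (1 + e^-1) * sqnorm w.
Proof.
move=> e0; rewrite !mulr_sumr -big_split; apply: ler_sum => j _.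
by rewrite mxE sqmodD_le.
Qed.

(* Allowing an arbitrary right-hand side Q is what makes the induction on the
   triangular matrix go through: Q absorbs the off-diagonal column. *)
Lemma trig_lyapunov (R : realType) n (A : 'M[R[i]]_n) :
    is_trig_mx A -> (forall i, sqmod (A i i) < 1) ->
  forall N (Q : 'M[R[i]]_(n, N)), exists M (W : 'M[R[i]]_(n, M)),
    forall v, sqnorm (v *m A *m W) + sqnorm (v *m Q) <= sqnorm (v *m W).
Proof.
elim: n A => [|n IHn] A /is_trig_mxP trigA diagA N Q.
  by exists 0, 0 => v; rewrite [v]thinmx0 !mul0mx !sqnorm0 addr0.
move: A Q trigA diagA; rewrite -[n.+1]/(1 + n)%N => A Q trigA diagA.
pose t := A 0 0; pose c := dlsubmx A; pose A' := drsubmx A.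
have AE : A = block_mx t%:M 0 c A'.
  rewrite -[A]submxK; congr block_mx.
    by apply/matrixP => i j; rewrite !mxE !ord1 lshift0.
  by apply/matrixP => i j; rewrite !mxE trigA//= ord1.
(* With W = diag(a, W'), the slack e splits the first entry of v A so that its
   diagonal part keeps the factor 1 - d < 1; a then dominates the first row of Q
   and b pays, through the induction hypothesis, for the column c. *)
pose r := sqmod t.
have r1 : r < 1 by apply: diagA.
have r0 : 0 <= r by apply: sqmod_ge0.
(* This choice makes [d] below equal to (1 - r)(1 - r / 2). *)
pose e := (1 - r) / 2.
have e0 : 0 < e by rewrite /e; lra.
pose d := 1 - (1 + e) * r.
have d0 : 0 < d by rewrite /d /e; nra.
have d1 : d <= 1 by rewrite /d /e; nra.
pose q0 := usubmx Q; pose q' := dsubmx Q.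
(* The factor 2 comes from [sqnormD_le] with parameter 1. The summand 1 in [a] and in [b] makes
   their squares large enough without square roots. *)
pose a := 1 + 2 * sqnorm q0 / d.
have a1 : 1 <= a by rewrite lerDl divr_ge0 ?mulr_ge0 ?sqnorm_ge0 ?ltW.
have ad : 2 * sqnorm q0 <= a ^+ 2 * d.
  have adE : a * d = d + 2 * sqnorm q0 by rewrite /a; field; rewrite gt_eqF.
  have : 0 <= (a - 1) * (a * d).
    by rewrite mulr_ge0 ?subr_ge0// adE; have := sqnorm_ge0 q0; lra.
  lra.
pose b := 1 + a ^+ 2 * (1 + e^-1).
have e'0 : 0 < e^-1 by rewrite invr_gt0.
have bb : a ^+ 2 * (1 + e^-1) <= b ^+ 2.
  have z0 : 0 <= a ^+ 2 * (1 + e^-1).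
    by rewrite mulr_ge0 ?sqr_ge0// addr_ge0// ltW.
  by rewrite /b; move: (a ^+ 2 * _) z0 => z z0; nra.
have trigA' : is_trig_mx A'.
  by apply/is_trig_mxP => i j ij; rewrite !mxE trigA.
have diagA' i : sqmod (A' i i) < 1 by rewrite !mxE diagA.
pose C x := real_complex R x.
have [M [W HW]] := IHn A' trigA' diagA' _ (row_mx (C b *: c) (C 2 *: q')).
exists (1 + M)%N, (block_mx (C a)%:M 0 0 W) => v.
rewrite -[v]hsubmxK AE -[Q]vsubmxK -/q0 -/q'.
set v0 := lsubmx v; set v' := rsubmx v.
rewrite !mul_row_block !mul_row_col !mulmx0 !addr0 !add0r !sqnorm_row_mx.
rewrite !mul_mx_scalar !sqnormZ !sqmod_real.
have := HW v'.
rewrite mul_mx_row sqnorm_row_mx -!scalemxAr !sqnormZ !sqmod_real.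
have {1}-> : v0 *m q0 = v0 0 0 *: q0.
  by rewrite [v0]mx11_scalar mul_scalar_mx !mxE eqxx.
have sv0 : sqnorm v0 = sqmod (v0 0 0) by rewrite /sqnorm big_ord1.
have := @sqnormD_le _ e _ (t *: v0) (v' *m c) e0.
have := @sqnormD_le _ 1 _ (v0 0 0 *: q0) (v' *m q') ltr01.
rewrite !sqnormZ -sv0 -/r invr1.
have := sqnorm_ge0 (v' *m q'); have := sqnorm_ge0 (v' *m c).
have := sqnorm_ge0 v0.
move: (sqnorm (t *: _ + _)) (sqnorm (_ + v' *m q')) => s1 s2.
move: (sqnorm (v' *m q')) (sqnorm (v' *m c)) (sqnorm v0) => X Y Z Z0 Y0 X0.
move: (sqnorm (v' *m A' *m W)) (sqnorm (v' *m W)) => U V le2 le1 leV.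
have : a ^+ 2 * s1 <= a ^+ 2 * ((1 + e) * (r * Z) + (1 + e^-1) * Y).
  by rewrite ler_wpM2l ?sqr_ge0.
have : (a ^+ 2 * (1 + e^-1)) * Y <= b ^+ 2 * Y by rewrite ler_wpM2r.
have : 2 * sqnorm q0 * Z <= a ^+ 2 * (1 - (1 + e) * r) * Z by rewrite ler_wpM2r.
clear -le1 le2 leV Z0 Y0 X0.
move: e^-1 => e'; move: (sqnorm q0) le2 => q2 le2.
by clearbody b e a r; lra.
Qed.

(** * Stable real matrices: triangular form, trace bound, Lyapunov factors *)

Lemma stable_trig (R : realType) n (A : 'M[R]_n) : stable A ->
  exists (P T : 'M[R[i]]_n), [/\ P \in unitmx, is_trig_mx T,
    forall i, sqmod (T i i) < 1 & P *m map_mx (real_complex R) A = T *m P].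
Proof.
move=> stA; case: (posnP n) => [n0|n_gt0].
  subst n; exists 1%:M, (map_mx (real_complex R) A).
  by split; rewrite ?unitmx1 ?mulmx1 ?mul1mx//; [apply/is_trig_mxP|]; case.
have [P Pu trT] := Schur (map_mx (real_complex R) A) n_gt0.
have Punit := unitarymx_unit Pu.
set A' := map_mx _ A in trT *; set T := conjmx P A' in trT.
have simPA : P *m A' = T *m P by apply/(similarP Punit)/eqP.
exists P, T; split=> // i; rewrite -norm_lt1; apply: stA.
have /eigenvalueP [v vT v0] : eigenvalue T (T i i).
  rewrite eigenvalue_root_char char_poly_trig// (bigD1 i)//= rootM.
  by rewrite root_XsubC eqxx.
apply/eigenvalueP; exists (v *m P).
  by rewrite -mulmxA simPA mulmxA vT scalemxAl.
by apply: contra v0 => /eqP vP; rewrite -(mulmxK Punit v) vP mul0mx.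
Qed.

(** The trace is invariant under similarity, hence the sum of the diagonal of the triangular form,
    whose entries have modulus below 1. *)
Lemma stable_trace_le (R : realType) n (A : 'M[R]_n) : stable A ->
  `|\tr A| <= n%:R.
Proof.
move=> /stable_trig [P [T [Pu _ Tlt PA]]].
rewrite -lecR /=.
have <- : `|\tr T| = (real_complex R `|\tr A|).
  have -> : \tr T = real_complex R (\tr A).
    rewrite -[T](mulmxK Pu) -PA mxtrace_mulC mulmxA mulVmx// mul1mx.
    by rewrite /mxtrace raddf_sum; apply: eq_bigr => i _; rewrite mxE.
  by rewrite normc_def /= expr0n /= addr0 sqrtr_sqr.
rewrite rmorph_nat (le_trans (ler_norm_sum _ _ _))//.
rewrite -[leRHS]mulr_natl -[n in n%:R]card_ord -sumr_const mulr_suml.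
by apply: ler_sum => i _; rewrite mulr1 ltW// norm_lt1.
Qed.

Definition sq (R : realType) (N : nat) (v : 'rV[R]_N) : R := \sum_j v 0 j ^+ 2.

(** With [P = W *m W^T] this is the strict Lyapunov inequality A P A^T < P; keeping the factor [W]
    avoids any theory of positive definite matrices. *)
Definition lyapunov_factor (R : realType) n N (A : 'M[R]_n)
    (W : 'M[R]_(n, N)) :=
  forall v : 'rV_n, v != 0 -> sq (v *m A *m W) < sq (v *m W).

Lemma sqnorm_realE (R : realType) N (v : 'rV[R[i]]_N) :
  sqnorm v = sq (map_mx (@complex.Re R) v) + sq (map_mx (@complex.Im R) v).
Proof. by rewrite -big_split; apply: eq_bigr => j _; rewrite !mxE. Qed.

Lemma map_Re_mulmx (R : realType) m n p (A : 'M[R[i]]_(m, n))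
    (B : 'M[R]_(n, p)) :
  map_mx (@complex.Re R) (A *m map_mx (real_complex R) B)
  = map_mx (@complex.Re R) A *m B.
Proof.
apply/matrixP => i j; rewrite !mxE raddf_sum; apply: eq_bigr => k _.
by rewrite !mxE; case: (A i k) => a b /=; ring.
Qed.

Lemma map_Im_mulmx (R : realType) m n p (A : 'M[R[i]]_(m, n))
    (B : 'M[R]_(n, p)) :
  map_mx (@complex.Im R) (A *m map_mx (real_complex R) B)
  = map_mx (@complex.Im R) A *m B.
Proof.
apply/matrixP => i j; rewrite !mxE raddf_sum; apply: eq_bigr => k _.
by rewrite !mxE; case: (A i k) => a b /=; ring.
Qed.

(** The triangular case with [Q = 1] gives a strict decrease for nonzero rows. The factor is carried
    back through [invmx P], and its real and imaginary parts side by side form a real one. *)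
Lemma stable_lyapunov (R : realType) n (A : 'M[R]_n) : stable A ->
  exists N (W : 'M[R]_(n, N)), lyapunov_factor A W.
Proof.
move=> /stable_trig [P [T [Pu trT Tlt PA]]].
have [M [W HW]] := trig_lyapunov trT Tlt 1%:M.
set A' := map_mx _ A in PA; pose V := invmx P *m W.
have sqV N (v : 'rV[R]_n) (B : 'M_(n, N)) :
    sq (v *m row_mx (map_mx (@complex.Re R) B) (map_mx (@complex.Im R) B))
    = sqnorm (map_mx (real_complex R) v *m B).
  rewrite sqnorm_realE mul_mx_row /sq big_split_ord /=.
  congr (_ + _); apply: eq_bigr => j _;
    rewrite ?row_mxEl ?row_mxEr !mxE raddf_sum; congr (_ ^+ 2);
    by apply: eq_bigr => k _; rewrite !mxE; case: (B k j) => a b /=; ring.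
exists (M + M)%N,
  (row_mx (map_mx (@complex.Re R) V) (map_mx (@complex.Im R) V)) => v v0.
rewrite !sqV map_mxM -/A'; set v' := map_mx _ v.
have PA' : A' *m invmx P = invmx P *m T.
  by rewrite -[T](mulmxK Pu) -PA -mulmxA mulKmx.
have := HW (v' *m invmx P); rewrite -[_ *m _ *m T]mulmxA -PA' mulmx1 -!mulmxA.
apply: lt_le_trans; rewrite ltrDl sqnorm_gt0//.
apply: contra v0 => /eqP/(congr1 (mulmx^~ P)); rewrite mulmxKV// mul0mx => v'0.
by apply/eqP/rowP => j; have /rowP/(_ j) := v'0; rewrite !mxE => -[].
Qed.

(** For a left eigenvector, the inequalities for its real and imaginary parts add up to |z|^2 |v
    W|^2 < |v W|^2. *)
Lemma lyapunov_stable (R : realType) n N (A : 'M[R]_n) (W : 'M[R]_(n, N)) :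
  lyapunov_factor A W -> stable A.
Proof.
move=> HW z /eigenvalueP [v vA v0]; rewrite norm_lt1.
pose a := map_mx (@complex.Re R) v; pose b := map_mx (@complex.Im R) v.
have le w : sq (w *m A *m W) <= sq (w *m W).
  by have [->|/HW/ltW//] := eqVneq w 0; rewrite !mul0mx.
have lt : sq (a *m A *m W) + sq (b *m A *m W) < sq (a *m W) + sq (b *m W).
  (* One of the two parts may vanish; strictness comes from a nonzero one. *)
  have [a0|/HW lta] := eqVneq a 0; last by rewrite ltr_leD.
  rewrite ler_ltD//; apply: HW; apply: contra v0 => /eqP b0.
  apply/eqP/rowP => j; apply/eqP; rewrite mxE eq_complex.
  have /rowP/(_ j) := a0; have /rowP/(_ j) := b0; rewrite !mxE => -> ->.
  by rewrite !eqxx.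
pose vW := v *m map_mx (real_complex R) W.
have vWE : sqnorm vW = sq (a *m W) + sq (b *m W).
  by rewrite sqnorm_realE map_Re_mulmx map_Im_mulmx.
have : sqnorm (z *: vW) = sq (a *m A *m W) + sq (b *m A *m W).
  rewrite scalemxAl -vA sqnorm_realE !(map_Re_mulmx, map_Im_mulmx).
  by rewrite /vW.
rewrite sqnormZ vWE => E; move: lt; rewrite -E -vWE.
have := sqnorm_ge0 vW; have := sqmod_ge0 z; move: (sqmod z) (sqnorm vW) => x y.
by nra.
Qed.

(** * From a stable closed loop to stabilizability and detectability, and the observer *)

Lemma sq_ge0 (R : realType) N (v : 'rV[R]_N) : 0 <= sq v.
Proof. by apply: sumr_ge0 => j _; exact: sqr_ge0. Qed.

Lemma sq_mulmx_tr (R : realType) N (v : 'rV[R]_N) : v *m v^T = (sq v)%:M.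
Proof.
rewrite [LHS]mx11_scalar mxE; congr _%:M.
by apply: eq_bigr => j _; rewrite mxE expr2.
Qed.

Lemma sq_eq0 (R : realType) N (v : 'rV[R]_N) : sq v = 0 -> v = 0.
Proof.
move=> v0; apply/rowP => j; rewrite mxE; apply/eqP; rewrite -sqrf_eq0.
by apply/eqP/(psumr_eq0P _ v0) => // i _; exact: sqr_ge0.
Qed.

Lemma sqD_orth (R : realType) N (v w : 'rV[R]_N) :
  v *m w^T = 0 -> sq (v + w) = sq v + sq w.
Proof.
move=> /matrixP/(_ 0 0); rewrite !mxE; under eq_bigr do rewrite mxE.
move=> /(congr1 ( *%R 2)); rewrite mulr0 => vw.
rewrite -[RHS]addr0 -vw mulr_sumr -!big_split; apply: eq_bigr => j _.
by rewrite mxE /=; ring.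
Qed.

Lemma stable_block_stabilizable (R : realType) n m k (A : 'M[R]_n)
    (B : 'M_(n, k)) (M : 'M_(k, m)) (C : 'M_(m, n)) (D : 'M_m) :
  stable (block_mx A (B *m M) C D) -> stabilizable A B.
Proof.
move=> /stable_lyapunov [N [W HW]].
pose W1 := usubmx W; pose W2 := dsubmx W.
have HW1 (v : 'rV_n) : v != 0 ->
    sq (v *m A *m W1 + v *m (B *m M) *m W2) < sq (v *m W1).
  move=> v0; have /HW : row_mx v (0 : 'rV_m) != 0.
    by apply: contra v0 => /eqP; rewrite -row_mx0 => /eq_row_mx [->].
  rewrite mul_row_block -[W]vsubmxK !mul_row_col !mul0mx !addr0.
  by rewrite -/W1 -/W2.
pose G := W1 *m W1^T.
(* If [v *m G = 0] then [sq (v *m W1) = 0], which the strict inequality [HW1] excludes for nonzero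
   [v]. *)
have Gunit : G \in unitmx.
  rewrite -row_free_unit; apply: inj_row_free => v vG.
  apply/eqP; apply: contraT => /HW1; rewrite [ltRHS](_ : _ = 0).
    by rewrite ltNge sq_ge0.
  have := sq_mulmx_tr (v *m W1).
  rewrite trmx_mul mulmxA -[v *m _ *m _]mulmxA vG.
  by rewrite mul0mx => /esym/matrixP/(_ 0 0); rewrite !mxE eqxx.
(* Least-squares coefficients: the rows of [P *m W1] are the orthogonal projections of those of [W2]
   on the row space of [W1]. *)
pose P := W2 *m W1^T *m invmx G.
exists (M *m P); apply: (@lyapunov_stable _ _ _ _ W1) => v v0.
apply: le_lt_trans (HW1 v v0); rewrite -/W1.
pose Z := W2 - P *m W1.
have ZW1 : W1 *m Z^T = 0.
  apply: trmx_inj; rewrite trmx_mul trmxK trmx0 /Z mulmxBl -!mulmxA -/G.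
  by rewrite /P mulVmx// mulmx1 subrr.
have -> : v *m A *m W1 + v *m (B *m M) *m W2
    = v *m (A + B *m (M *m P)) *m W1 + v *m (B *m M) *m Z.
  rewrite /Z mulmxBr mulmxDr mulmxDl !mulmxA -addrA.
  by rewrite [X in _ = _ + X]addrC subrK.
rewrite sqD_orth ?lerDl ?sq_ge0//.
by rewrite trmx_mul -!mulmxA (mulmxA W1) ZW1 mul0mx !mulmx0.
Qed.

Lemma stable_tr (R : realType) n (A : 'M[R]_n) : stable A -> stable A^T.
Proof.
move=> stA z; rewrite -map_trmx !eigenvalue_root_char => zA.
apply: stA; rewrite eigenvalue_root_char.
suff <- : char_poly (map_mx (real_complex R) A)^T
  = char_poly (map_mx (real_complex R) A) by [].
rewrite /char_poly -[RHS]det_tr; congr (\det _).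
by apply/matrixP => i j; rewrite !mxE eq_sym.
Qed.

Lemma stable_block_detectable (R : realType) n p m (A : 'M[R]_n)
    (B : 'M_(n, m)) (L : 'M_(m, p)) (C : 'M_(p, n)) (D : 'M_m) :
  stable (block_mx A B (L *m C) D) -> detectable C A.
Proof.
move=> /stable_tr; rewrite tr_block_mx trmx_mul.
move=> /stable_block_stabilizable [F /stable_tr].
rewrite linearD /= trmx_mul !trmxK => stF.
by exists (- F^T); rewrite mulNmx opprK.
Qed.

(** Separation principle: for a left eigenvector [[v1 v2]], the sum [v1 + v2] is a left eigenvector
    of [A + B *m F], unless it is zero, and then [v1] is one of [A - L *m C]. *)
Lemma stable_observer (R : realType) n m p (A : 'M[R]_n) (B : 'M_(n, m))
    (C : 'M_(p, n)) (F : 'M_(m, n)) (L : 'M_(n, p)) :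
  stable (A + B *m F) -> stable (A - L *m C) ->
  stable (block_mx A (B *m F) (L *m C) (A + B *m F - L *m C)).
Proof.
move=> stF stL z /eigenvalueP [v]; rewrite -[v]hsubmxK.
set v1 := lsubmx v; set v2 := rsubmx v.
rewrite map_block_mx mul_row_block scale_row_mx => /eq_row_mx [E1 E2] v0.
have [v12|v12] := eqVneq (v1 + v2) 0.
  have v2E : v2 = - v1 by apply/eqP; rewrite -addr_eq0 addrC v12.
  apply: stL; apply/eigenvalueP; exists v1.
    by rewrite map_mxB mulmxBr -E1 v2E mulNmx.
  by apply: contra v0 => /eqP v10; rewrite v2E v10 oppr0 row_mx0.
apply: stF; apply/eigenvalueP; exists (v1 + v2) => //.
rewrite scalerDr -E1 -E2 map_mxB map_mxD mulmxBr mulmxDl addrACA -mulmxDr.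
by congr (_ + _); rewrite addrC subrK.
Qed.

(** * Consistent systems, necessity of the conditions and the controller *)

Lemma right_inverseE (R : realType) n k N (Xm : 'M[R]_(n, N)) (Uhat : 'M_(k, N))
    V1 V2 : is_right_inverse Xm Uhat V1 V2 ->
  [/\ Xm *m V1 = 1%:M, Xm *m V2 = 0, Uhat *m V1 = 0 & Uhat *m V2 = 1%:M].
Proof. by rewrite /is_right_inverse mul_col_row => /eq_block_mx []. Qed.

Lemma rank_col_mxP (R : realType) n k N (Xm : 'M[R]_(n, N))
    (Uhat : 'M_(k, N)) :
  \rank (col_mx Xm Uhat) = (n + k)%N <->
  exists V1 V2, is_right_inverse Xm Uhat V1 V2.
Proof.
split=> [/eqP/row_freeP [V HV]|[V1 [V2 HV]]].
  exists (lsubmx V), (rsubmx V).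
  by rewrite /is_right_inverse hsubmxK HV -scalar_mx_block.
apply/eqP; change (row_free (col_mx Xm Uhat)); apply/row_freeP.
by exists (row_mx V1 V2); rewrite HV -scalar_mx_block.
Qed.

Lemma Sigma_isoP (R : realType) n m p q (T : 'I_q -> nat)
    (u : 'I_q -> nat -> 'cV[R]_m) x y (s : system R n m p) :
  Sigma_iso T u x y s <->
  Xplus T x = sysA s *m Xminus T x + sysB s *m blocks T u /\
  blocks T y = sysC s *m Xminus T x + sysD s *m blocks T u.
Proof.
by rewrite /Sigma_iso /= mul_block_col; split=> [/eq_col_mx//|[-> ->]//].
Qed.

Lemma generated_by_Sigma_iso (R : realType) n m p q (T : 'I_q -> nat)
    (s : system R n m p) (u : 'I_q -> nat -> 'cV[R]_m) x y :
  generated_by T s u x y -> Sigma_iso T u x y s.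
Proof.
move=> data; apply/Sigma_isoP; split; apply/matrixP => i j.
  rewrite !mxE (data _ _ (ltn_ord _)).1 !mxE.
  by congr (_ + _); apply: eq_bigr => l _; rewrite !mxE.
rewrite !mxE (data _ _ (ltn_ord _)).2 !mxE.
by congr (_ + _); apply: eq_bigr => l _; rewrite !mxE.
Qed.

Lemma Sigma_iso_right_inverse (R : realType) n m p q (T : 'I_q -> nat)
    (u : 'I_q -> nat -> 'cV[R]_m) x y (s : system R n m p) k (S : 'M_(m, k))
    (Uhat : 'M_(k, \sum_(i < q) T i)) V1 V2 :
  blocks T u = S *m Uhat -> is_right_inverse (Xminus T x) Uhat V1 V2 ->
  Sigma_iso T u x y s ->
  [/\ Xplus T x *m V1 = sysA s, Xplus T x *m V2 = sysB s *m S,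
      blocks T y *m V1 = sysC s & blocks T y *m V2 = sysD s *m S].
Proof.
move=> UE /right_inverseE [XV1 XV2 UV1 UV2] /Sigma_isoP; rewrite UE => -[-> ->].
rewrite !mulmxDl -!mulmxA XV1 XV2 UV1 UV2.
by rewrite !(mulmx0, mulmx1, addr0, add0r).
Qed.

Lemma informative_row_free (R : realType) n m p q (T : 'I_q -> nat)
    (s : system R n m p) (u : 'I_q -> nat -> 'cV[R]_m) x y k (S : 'M_(m, k))
    (Uhat : 'M_(k, \sum_(i < q) T i)) :
  Sigma_iso T u x y s -> row_full S -> row_free Uhat ->
  blocks T u = S *m Uhat -> informative T u x y ->
  row_free (col_mx (Xminus T x) Uhat).
Proof.
move=> /Sigma_isoP [XE YE] /row_fullP [S' S'S] freeU UE [nw [K [L [M sub]]]].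
apply: inj_row_free => v; rewrite -[v]hsubmxK mul_row_col.
set xi := lsubmx v; set eta := rsubmx v => ker.
suff xi0 : xi = 0.
  move: ker; rewrite xi0 mul0mx add0r => etaU; rewrite (_ : eta = 0) ?row_mx0//.
  by apply: (row_free_inj freeU); rewrite etaU mul0mx.
apply: sq_eq0; apply/eqP; apply: contraT => sq_neq0.
have sq_gt0 : 0 < sq xi by rewrite lt_def sq_neq0 sq_ge0.
pose c := \tr (sysA s) + \tr (K + L *m sysD s *m M).
(* The perturbation below adds [t * sq xi] to the closed-loop trace [c], which pushes it above the
   bound [n + nw]. *)
pose t := (`|c| + (n + nw)%:R + 1) / sq xi.
(* As [S'] is a left inverse of [S], [eta *m S'] acts on the inputs as [eta] on [Uhat], so the data
   do not see the perturbation. The change in B enters only an off-diagonal block, so it leaves the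
   trace alone. *)
pose s' := System (sysA s + t *: (xi^T *m xi))
  (sysB s + t *: (xi^T *m (eta *m S'))) (sysC s) (sysD s).
have /sub/stable_trace_le : Sigma_iso T u x y s'.
  apply/Sigma_isoP; split=> //=.
  rewrite !mulmxDl addrACA -XE -!scalemxAl -scalerDr -!mulmxA -mulmxDr.
  by rewrite UE (mulmxA S') S'S mul1mx ker mulmx0 scaler0 addr0.
rewrite mxtrace_block /= linearD linearZ /= mxtrace_mulC sq_mulmx_tr.
rewrite mxtrace_scalar mulr1n addrAC -/c divfK//.
set N := (n + nw)%:R => le_N.
have : c + (`|c| + N + 1) <= N by apply: le_trans le_N; rewrite ler_norm.
have : - c <= `|c| by rewrite -normrN ler_norm.
by move: (`|c|) => a lea; rewrite leNgt; case/negP; clear -lea; lra.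
Qed.

Lemma informative_stabilizable_detectable (R : realType) n m p q
    (T : 'I_q -> nat) (s : system R n m p) (u : 'I_q -> nat -> 'cV[R]_m) x y k
    (S : 'M_(m, k)) (Uhat : 'M_(k, \sum_(i < q) T i)) V1 V2 :
  Sigma_iso T u x y s -> row_full S -> blocks T u = S *m Uhat ->
  is_right_inverse (Xminus T x) Uhat V1 V2 -> informative T u x y ->
  stabilizable_detectable (Xplus T x) (blocks T y) V1 V2.
Proof.
move=> sS /row_fullP [S' S'S] UE HV [nw [K [L [M sub]]]].
rewrite /stabilizable_detectable.
have [-> -> -> _] := Sigma_iso_right_inverse UE HV sS.
(* B is only determined on the image of S; the consistent choice B S S' turns
   the input of the controller into an input of the pair (A, B S). *)
pose s' := System (sysA s) (sysB s *m S *m S') (sysC s) (sysD s).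
have /sub st : Sigma_iso T u x y s'.
  move/Sigma_isoP: sS => [XE YE]; apply/Sigma_isoP; split=> //=.
  by rewrite XE UE -!mulmxA (mulmxA S') S'S mul1mx.
move: st; rewrite /Sigma_KLM /= -mulmxA => st; split.
  exact: stable_block_stabilizable st.
exact: stable_block_detectable st.
Qed.

Lemma Sigma_iso_sub_Sigma_KLM (R : realType) n m p q (T : 'I_q -> nat)
    (u : 'I_q -> nat -> 'cV[R]_m) x y k (S : 'M_(m, k))
    (Uhat : 'M_(k, \sum_(i < q) T i)) V1 V2 (Mhat : 'M_(k, n)) (L : 'M_(n, p)) :
  let Xp := Xplus T x in let Ym := blocks T y in
  blocks T u = S *m Uhat -> is_right_inverse (Xminus T x) Uhat V1 V2 ->
  stable (Xp *m (V1 + V2 *m Mhat)) -> stable ((Xp - L *m Ym) *m V1) ->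
  Sigma_iso T u x y `<=`
    Sigma_KLM ((Xp - L *m Ym) *m (V1 + V2 *m Mhat)) L (S *m Mhat).
Proof.
move=> Xp Ym UE HV stM stL s sS.
have [E1 E2 E3 E4] := Sigma_iso_right_inverse UE HV sS.
move: stM stL; rewrite /Sigma_KLM /= mulmxDr mulmxBl -!(mulmxA L) mulmxA.
rewrite /Xp /Ym E1 E2 E3 => stM stL.
(* The unknown feedthrough cancels: K already contains the opposite of
   [L *m sysD s *m S *m Mhat]. *)
have -> : (Xplus T x - L *m blocks T y) *m (V1 + V2 *m Mhat)
      + L *m (sysD s *m (S *m Mhat))
    = sysA s + sysB s *m S *m Mhat - L *m sysC s.
  rewrite mulmxBl !mulmxDr -!mulmxA !(mulmxA _ V2) E1 E2 E3 E4.
  by rewrite opprD addrA -!mulmxA subrK.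
by rewrite mulmxA; exact: (stable_observer stM stL).
Qed.

(** Condition (ii) is read both for some and for every right inverse: the products in it equal A, B
    S and C of any consistent system, whichever right inverse is taken. *)
Theorem corollary36 (R : realType) (n m p q : nat) (T : 'I_q -> nat)
    (n_gt0 : (0 < n)%N) (m_gt0 : (0 < m)%N) (p_gt0 : (0 < p)%N)
    (q_gt0 : (0 < q)%N) (T_gt0 : forall i, (0 < T i)%N)
    (s : system R n m p) (u : 'I_q -> nat -> 'cV[R]_m)
    (x : 'I_q -> nat -> 'cV[R]_n) (y : 'I_q -> nat -> 'cV[R]_p)
    (data : generated_by T s u x y)
    (k : nat) (S : 'M[R]_(m, k)) (Uhat : 'M[R]_(k, \sum_(i < q) T i))
    (S_full_col_rank : \rank S = k) (Uhat_full_row_rank : \rank Uhat = k)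
    (U_factor : blocks T u = S *m Uhat) :
  let Xm := Xminus T x in
  let Xp := Xplus T x in
  let Ym := blocks T y in
  let cond_i := \rank (col_mx Xm Uhat) = (n + k)%N in
  [/\ cond_i <-> (exists V1 V2, is_right_inverse Xm Uhat V1 V2),
      informative T u x y <->
        cond_i /\ (exists V1 V2, is_right_inverse Xm Uhat V1 V2 /\
                                 stabilizable_detectable Xp Ym V1 V2),
      informative T u x y <->
        cond_i /\ (forall V1 V2, is_right_inverse Xm Uhat V1 V2 ->
                                 stabilizable_detectable Xp Ym V1 V2)
    & forall V1 V2, is_right_inverse Xm Uhat V1 V2 ->
        stabilizable_detectable Xp Ym V1 V2 ->
        [/\ exists Mhat : 'M[R]_(k, n), stable (Xp *m (V1 + V2 *m Mhat)),
            exists L : 'M[R]_(n, p), stable ((Xp - L *m Ym) *m V1)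
          & forall (Mhat : 'M[R]_(k, n)) (L : 'M[R]_(n, p)),
              stable (Xp *m (V1 + V2 *m Mhat)) ->
              stable ((Xp - L *m Ym) *m V1) ->
              let M := S *m Mhat in
              let K := (Xp - L *m Ym) *m (V1 + V2 *m Mhat) in
              Sigma_iso T u x y `<=` Sigma_KLM K L M]].
Proof.
move=> Xm Xp Ym cond_i.
have sS := generated_by_Sigma_iso data.
have fullS : row_full S by rewrite /row_full S_full_col_rank.
have freeU : row_free Uhat by rewrite /row_free Uhat_full_row_rank.
have cond_iP := rank_col_mxP Xm Uhat.
have inf_i : informative T u x y -> cond_i.
  by move/(informative_row_free sS fullS freeU U_factor)/eqP.
have inf_ii V1 V2 : is_right_inverse Xm Uhat V1 V2 -> informative T u x y ->
    stabilizable_detectable Xp Ym V1 V2.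
  exact: informative_stabilizable_detectable sS fullS U_factor.
have design V1 V2 : stabilizable_detectable Xp Ym V1 V2 ->
    (exists Mhat : 'M[R]_(k, n), stable (Xp *m (V1 + V2 *m Mhat))) /\
    (exists L : 'M[R]_(n, p), stable ((Xp - L *m Ym) *m V1)).
  move=> [[F stF] [G stG]]; split.
    by exists F; rewrite mulmxDr (mulmxA Xp); exact: stF.
  by exists G; rewrite mulmxBl -(mulmxA G); exact: stG.
have suff_inf V1 V2 : is_right_inverse Xm Uhat V1 V2 ->
    stabilizable_detectable Xp Ym V1 V2 -> informative T u x y.
  move=> HV /design [[Mhat stM] [L stL]].
  by do 4?eexists; exact: (Sigma_iso_sub_Sigma_KLM U_factor HV stM stL).
split=> //.
- split=> [inf|[_ [V1 [V2 [HV sd]]]]]; last exact: suff_inf HV sd.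
  have /inf_i/cond_iP [V1 [V2 HV]] := inf.
  by split; [exact: inf_i|exists V1, V2; split=> //; exact: inf_ii].
- split=> [inf|[/cond_iP [V1 [V2 HV]] sd]]; last exact: suff_inf HV (sd _ _ HV).
  by split=> [|V1 V2 HV]; [exact: inf_i|exact: inf_ii].
- move=> V1 V2 HV /design [exM exL]; split=> // Mhat L stM stL M K.
  exact: Sigma_iso_sub_Sigma_KLM U_factor HV stM stL.
Qed.
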